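(* Let $\Sigma=(X,\mathcal{U},\phi)$ be a forward complete control system. The following statements are equivalent: (i) $\Sigma$ is sISS. (ii) $\Sigma$ is sAG and UGS. (iii) $\Sigma$ is sLIM and UGS.
   Context: A forward complete control system $\Sigma=(X,\mathcal{U},\phi)$ consists of: a normed linear space $(X,\|\cdot\|_X)$; a set $U$ of input values, a nonempty subset of a normed linear space; a set $\mathcal{U}\subset\{f:\mathbb{R}_+\to U\}$ of inputs endowed with a norm $\|\cdot\|_{\mathcal{U}}$, containing the zero input, such that for all $u\in\mathcal{U}$, $\tau\ge 0$ the shift $u(\cdot+\tau)$ lies in $\mathcal{U}$ with $\|u(\cdot+\tau)\|_{\mathcal{U}}\le\|u\|_{\mathcal{U}}$, and such that for all $u_1,u_2\in\mathcal{U}$, $t>0$ the concatenation ($u(\tau)=u_1(\tau)$ for $\tau\in[0,t]$, $u(\tau)=u_2(\tau-t)$ for $\tau>t$) lies in $\mathcal{U}$; and a map $\phi:\mathbb{R}_+\times X\times\mathcal{U}\to X$, defined everywhere, such that: $\phi(0,x,u)=x$; (causality) if $u(s)=\tilde u(s)$ for all $s\in[0,t]$ then $\phi(t,x,u)=\phi(t,x,\tilde u)$; $t\mapsto\phi(t,x,u)$ is continuous; (cocycle) $\phi(h,\phi(t,x,u),u(t+\cdot))=\phi(t+h,x,u)$ for all $t,h\ge0$. $\mathcal{K}$: continuous strictly increasing $\gamma:\mathbb{R}_+\to\mathbb{R}_+$ with $\gamma(0)=0$; $\mathcal{K}_\infty$: unbounded elements of $\mathcal{K}$; $\mathcal{L}$: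 continuous strictly decreasing $\gamma:\mathbb{R}_+\to\mathbb{R}_+$ with limit $0$ at $\infty$. - sISS (strong input-to-state stability): there are $\gamma\in\mathcal{K}$, $\sigma\in\mathcal{K}_\infty$, $\beta:X\times\mathbb{R}_+\to\mathbb{R}_+$ such that $\beta(x,\cdot)\in\mathcal{L}$ for all $x\in X$, $x\ne0$; $\beta(x,t)\le\sigma(\|x\|_X)$ for all $x\in X$, $t\ge0$; and $\|\phi(t,x,u)\|_X\le\beta(x,t)+\gamma(\|u\|_{\mathcal{U}})$ for all $x\in X$, $u\in\mathcal{U}$, $t\ge0$. - sAG (strong asymptotic gain): there is $\gamma\in\mathcal{K}_\infty\cup\{0\}$ such that for all $x\in X$, $\varepsilon>0$ there is $\tau=\tau(\varepsilon,x)<\infty$ such that for all $u\in\mathcal{U}$ and $t\ge\tau$: $\|\phi(t,x,u)\|_X\le\varepsilon+\gamma(\|u\|_{\mathcal{U}})$. - sLIM (strong limit property): there is $\gamma\in\mathcal{K}\cup\{0\}$ such that for all $\varepsilon>0$, $x\in X$ there is $\tau=\tau(\varepsilon,x)$ such that for all $u\in\mathcal{U}$ there is $t\le\tau$ with $\|\phi(t,x,u)\|_X\le\varepsilon+\gamma(\|u\|_{\mathcal{U}})$. - UGS: there are $\sigma\in\mathcal{K}_\infty$, $\gamma\in\mathcal{K}_\infty\cup\{0\}$ with $\|\phi(t,x,u)\|_X\le\sigma(\|x\|_X)+\gamma(\|u\|_{\mathcal{U}})$ for all $x\in X$, $u\in\mathcal{U}$, $t\ge0$. *)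

(* Defs.v *)
From HB Require Import structures.
From mathcomp Require Import all_boot all_order all_algebra.
From mathcomp Require Import all_classical all_reals all_analysis.
Import Order.TTheory GRing.Theory Num.Theory numFieldNormedType.Exports.

Set Implicit Arguments.
Unset Strict Implicit.
Unset Printing Implicit Defensive.

Local Open Scope classical_set_scope.
Local Open Scope ring_scope.

(* Comparison functions R_+ -> R_+ are represented by functions on R of which
   only the restriction to [0, +oo[ is constrained.  That they map [0, +oo[ to
   itself follows from monotonicity together with the value at 0 (class_K) or
   the limit at +oo (class_L). *)
Section ComparisonFunctions.
Variable R : realType.
Implicit Type g : R -> R.

Definition class_K g : Prop :=
  [/\ {within `[0, +oo[, continuous g},
      {in `[0, +oo[ &, {homo g : r s / r < s}} &
      g 0 = 0].

Definition class_Kinf g : Prop :=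
  class_K g /\ forall M : R, exists2 r, 0 <= r & M < g r.

Definition class_L g : Prop :=
  [/\ {within `[0, +oo[, continuous g},
      {in `[0, +oo[ &, {homo g : r s /~ r < s}} &
      g r @[r --> +oo] --> (0 : R)].

Definition zero_on_nonneg g : Prop := forall r, 0 <= r -> g r = 0.

End ComparisonFunctions.

(* Time ranges over the type {nonneg R}, so that an input is a function on R_+
   and nothing else: no values at negative times enter its identity. *)
Section Inputs.
Variables (R : realType) (V : Type).
Implicit Types (s t : {nonneg R}) (u : {nonneg R} -> V).

Definition time_add s t : {nonneg R} := (s%:num + t%:num)%:nng.

Definition shift t u : {nonneg R} -> V := fun s => u (time_add s t).

(* The absolute value only serves to land in {nonneg R}: it is applied to
   s - t when t < s. *)
Definition concat t u1 u2 : {nonneg R} -> V :=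
  fun s => if s%:num <= t%:num then u1 s else u2 (`|s%:num - t%:num|%:nng).

End Inputs.

(* Forward completeness is the totality of [phi] in its first two arguments
   and on all admissible inputs; the values of [phi] and [input_norm] outside
   [inputs] are irrelevant.  As [inputs] is only a set, not necessarily a linear
   subspace, the norm axioms are required whenever all the functions they
   mention belong to [inputs].  In [phi_continuous], R_+ carries the topology
   induced by R. *)
Record control_system (R : realType) (X V : normedModType R) := ControlSystem {
  input_values : set V;
  input_values_nonempty : input_values !=set0;
  inputs : set ({nonneg R} -> V);
  inputs_values : forall u, inputs u -> forall t, input_values (u t);
  inputs0 : inputs (fun=> 0);

  input_norm : ({nonneg R} -> V) -> R;
  input_norm_ge0 : forall u, inputs u -> 0 <= input_norm u;
  input_norm_eq0 : forall u, inputs u -> input_norm u = 0 -> u = (fun=> 0);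
  input_normZ : forall (a : R) u, inputs u -> inputs (fun t => a *: u t) ->
    input_norm (fun t => a *: u t) = `|a| * input_norm u;
  input_normD : forall u v, inputs u -> inputs v ->
    inputs (fun t => u t + v t) ->
    input_norm (fun t => u t + v t) <= input_norm u + input_norm v;

  inputs_shift : forall t u, inputs u -> inputs (shift t u);
  input_norm_shift : forall t u, inputs u ->
    input_norm (shift t u) <= input_norm u;
  inputs_concat : forall (t : {nonneg R}) u1 u2, 0 < t%:num ->
    inputs u1 -> inputs u2 -> inputs (concat t u1 u2);

  phi : {nonneg R} -> X -> ({nonneg R} -> V) -> X;
  phi0 : forall x u, inputs u -> phi 0%:nng x u = x;
  phi_causal : forall (t : {nonneg R}) x u v, inputs u -> inputs v ->
    (forall s : {nonneg R}, s%:num <= t%:num -> u s = v s) ->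
    phi t x u = phi t x v;
  phi_continuous : forall x u, inputs u ->
    continuous ((fun t => phi t x u)
      : initial_topology (fun t : {nonneg R} => t%:num) -> X);
  phi_cocycle : forall t h x u, inputs u ->
    phi h (phi t x u) (shift t u) = phi (time_add t h) x u
}.

Section Stability.
Variables (R : realType) (X V : normedModType R) (S : control_system X V).

Definition sISS : Prop :=
  exists (gamma sigma : R -> R) (beta : X -> R -> R),
    [/\ class_K gamma, class_Kinf sigma,
        forall x t, 0 <= t -> 0 <= beta x t,
        forall x, x != 0 -> class_L (beta x) &
        (forall x t, 0 <= t -> beta x t <= sigma `|x|) /\
        (forall x u (t : {nonneg R}), inputs S u ->
           `|phi S t x u| <= beta x t%:num + gamma (input_norm S u))].

Definition sAG : Prop :=
  exists2 gamma : R -> R, class_Kinf gamma \/ zero_on_nonneg gamma &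
    forall (x : X) (eps : R), 0 < eps ->
      exists tau : {nonneg R}, forall u (t : {nonneg R}), inputs S u ->
        tau%:num <= t%:num ->
        `|phi S t x u| <= eps + gamma (input_norm S u).

Definition sLIM : Prop :=
  exists2 gamma : R -> R, class_K gamma \/ zero_on_nonneg gamma &
    forall (eps : R) (x : X), 0 < eps ->
      exists tau : {nonneg R}, forall u, inputs S u ->
        exists2 t : {nonneg R}, t%:num <= tau%:num &
          `|phi S t x u| <= eps + gamma (input_norm S u).

Definition UGS : Prop :=
  exists sigma gamma : R -> R,
    [/\ class_Kinf sigma, class_Kinf gamma \/ zero_on_nonneg gamma &
        forall x u (t : {nonneg R}), inputs S u ->
          `|phi S t x u| <= sigma `|x| + gamma (input_norm S u)].

End Stability.

(* Main.v *)
Require Import Defs.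
From HB Require Import structures.
From mathcomp Require Import all_boot all_order all_algebra.
From mathcomp Require Import all_classical all_reals all_analysis.
From mathcomp Require Import lra.
Import Order.TTheory GRing.Theory Num.Theory numFieldNormedType.Exports.

(** The cycle sISS => sAG and UGS => sLIM and UGS => sAG and UGS => sISS is what
    has to be shown; its last two implications carry the content.

    From sLIM and UGS to sAG ([sLIM_UGS_sAG]): sLIM brings every trajectory from
    [x] below [d / 2 + gamma ||u||] at some time before a bound [tau] common to
    all inputs.  Restarting there, UGS keeps it below
    [sigma (d / 2 + gamma ||u||)] plus a gain from then on, because shifting an
    input does not increase its norm.  Since
    [sigma (a + b) <= sigma (2 a) + sigma (2 b)], this is at most
    [sigma d + sigma (2 gamma ||u||)] plus a gain, and [sigma d] is as small as
    desired.

    From sAG and UGS to sISS ([sAG_UGS_sISS]): let [G] dominate both gains.  For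
    a fixed [x], consider all pairs [(t, ||phi(t,x,u)|| - G ||u||)], for all
    times and inputs together.  Their second components are at most
    [sigma ||x||] by UGS, and small at large times by sAG.  They therefore lie
    below the graph of a continuous nonincreasing function that is at most
    [sigma ||x||] and tends to 0.  Instead of interpolating between the
    countably many times at which sAG yields the precisions 2^-k, the proof takes
    the least nonnegative 1-Lipschitz nonincreasing one, [envelope], which
    is given by a single supremum.  Adding [||x|| exp (-t)] makes it strictly
    decreasing, at the cost of replacing [sigma r] by [sigma r + r]. *)

Set Implicit Arguments.
Unset Strict Implicit.
Unset Printing Implicit Defensive.

Local Open Scope classical_set_scope.
Local Open Scope ring_scope.

(** * Comparison functions *)

Section ComparisonFunctions.
Variable R : realType.
Implicit Types (f g : R -> R) (a b r s : R).

Lemma class_K_le g r s : class_K g -> 0 <= r -> r <= s -> g r <= g s.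
Proof.
move=> [_ inc _] r0; rewrite le_eqVlt => /predU1P[->//|rs].
by apply/ltW/inc; rewrite // in_itv /= andbT// (le_trans r0)// ltW.
Qed.

Lemma class_K_ge0 g r : class_K g -> 0 <= r -> 0 <= g r.
Proof. by move=> Kg r0; case: (Kg) => _ _ <-; exact: class_K_le. Qed.

Lemma class_Kinf_id : class_Kinf (id : R -> R).
Proof.
split; first by split=> //; apply: continuous_subspaceT => x; exact: cvg_id.
move=> M; exists (`|M| + 1); first exact: addr_ge0.
by rewrite (le_lt_trans (ler_norm M))// ltrDl.
Qed.

Lemma class_KinfD f g :
  class_K f -> class_Kinf g -> class_Kinf (fun r => f r + g r).
Proof.
move=> Kf [Kg gy]; case: (Kf) (Kg) => [cf incf f0] [cg incg g0].
split; first split.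
- by move=> x; apply: cvgD; [exact: cf|exact: cg].
- by move=> r s rI sI rs; rewrite ltrD// ?incf ?incg.
- by rewrite f0 g0 addr0.
- move=> M; have [r r0 Mr] := gy M; exists r => //.
  by rewrite (lt_le_trans Mr)// lerDr class_K_ge0.
Qed.

Lemma class_Kinf_comp f g :
  class_Kinf f -> class_Kinf g -> class_Kinf (f \o g).
Proof.
move=> [Kf fy] [Kg gy]; case: (Kf) (Kg) => [cf incf f0] [cg incg g0].
have gI x : x \in `[0, +oo[ -> g x \in `[0, +oo[.
  by rewrite !in_itv /= !andbT; exact: class_K_ge0.
split; first split.
- apply/subspace_continuousP => x x0.
  apply: (@cvg_comp _ _ _ g f _ (within `[0, +oo[ (nbhs (g x)))); last first.
    by move/subspace_continuousP : cf; apply; exact: gI.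
  move=> B Bg; move/subspace_continuousP : cg => /(_ x x0 _ Bg).
  by apply: (@filterS _ (nbhs x) _) => y yB y0; apply: yB => //; exact: gI.
- by move=> r s rI sI rs; apply: incf; rewrite ?gI// incg.
- by rewrite /= g0.
- move=> M; have [r r0 Mr] := fy M; have [s s0 rs] := gy r.
  exists s => //=; apply: (lt_le_trans Mr).
  by rewrite (class_K_le Kf)// ltW.
Qed.

(** The gains of sAG, sLIM, UGS and sISS belong to different classes, two of
    which contain the zero function.  Since enlarging a gain preserves each
    property, this lemma reduces all of them to class Kinf. *)
Lemma gain_majorant g : class_K g \/ zero_on_nonneg g ->
  exists2 g', class_Kinf g' & forall r, 0 <= r -> g r <= g' r.
Proof.
move=> [Kg|g0]; last first.
  by exists id; [exact: class_Kinf_id|move=> r r0; rewrite g0].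
exists (fun r => g r + r); first exact: class_KinfD class_Kinf_id.
by move=> r r0; rewrite lerDl.
Qed.

Lemma class_K_small g e : class_K g -> 0 < e -> exists2 d, 0 < d & g d <= e.
Proof.
move=> [/subspace_continuousP cg _ g0] e0.
have /cvgrPdist_le/(_ _ e0) := cg 0 ltac:(by rewrite /= in_itv/= lexx).
rewrite near_withinE => /nbhs_ballP[d /= d0 dg].
exists (d / 2); first by rewrite divr_gt0.
rewrite (le_trans (ler_norm _))// -normrN -[- _]sub0r -[X in X - _]g0.
apply: dg.
- by rewrite /ball/= sub0r normrN ger0_norm ?divr_ge0 ?ltW//; move: d0; lra.
- by rewrite in_itv /= andbT divr_ge0// ltW.
Qed.

(** The weak triangle inequality: [a + b] is at most twice the larger of the
    two. *)
Lemma class_K_split g a b : class_K g -> 0 <= a -> 0 <= b ->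
  g (a + b) <= g (a + a) + g (b + b).
Proof.
move=> Kg a0 b0; have [ab|/ltW ba] := leP a b.
  by rewrite (le_trans (class_K_le (s := b + b) Kg _ _))//;
    [lra|lra|rewrite lerDr class_K_ge0//; lra].
by rewrite (le_trans (class_K_le (s := a + a) Kg _ _))//;
  [lra|lra|rewrite lerDl class_K_ge0//; lra].
Qed.

End ComparisonFunctions.

(** * Least 1-Lipschitz nonincreasing majorant of a planar set *)

Section Envelope.
Variables (R : realType) (A : set (R * R)) (M : R).
Hypotheses (M0 : 0 <= M) (AM : forall p, A p -> p.2 <= M).

Let values (t : R) : set R :=
  0 |` ((fun p => p.2 - Num.max 0 (t - p.1)) @` A).

(** A point [p] forces a 1-Lipschitz nonincreasing majorant of [A] to be at least
    [p.2] up to time [p.1], and at least [p.2] minus the elapsed time afterwards.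
    The supremum of these lower bounds inherits both properties.  The value 0
    is added to make it nonnegative and to cover an empty [A]. *)
Definition envelope (t : R) : R := sup (values t).

Lemma envelope_le t b : 0 <= b ->
  (forall p, A p -> p.2 - Num.max 0 (t - p.1) <= b) -> envelope t <= b.
Proof.
move=> b0 Ab; apply: ge_sup; first by exists 0; left.
by move=> _ [->//|[p Ap <-]]; exact: Ab.
Qed.

Lemma values_bounded t : has_ubound (values t).
Proof.
exists M => _ [->//|[p Ap <-]]; rewrite (le_trans _ (AM Ap))// gerBl.
by rewrite le_max lexx.
Qed.

Lemma envelope_ge0 t : 0 <= envelope t.
Proof. by apply: ub_le_sup; [exact: values_bounded|left]. Qed.

Lemma envelope_ge t p : A p -> p.2 - Num.max 0 (t - p.1) <= envelope t.
Proof.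
by move=> Ap; apply: ub_le_sup; [exact: values_bounded|right; exists p].
Qed.

Lemma envelope_majorant p : A p -> p.2 <= envelope p.1.
Proof. by move=> /(@envelope_ge p.1); rewrite subrr maxxx subr0. Qed.

Lemma envelope_bounded t : envelope t <= M.
Proof.
apply: envelope_le => // p Ap.
by rewrite (le_trans _ (AM Ap))// gerBl le_max lexx.
Qed.

Lemma envelope_nonincreasing s t : s <= t -> envelope t <= envelope s.
Proof.
move=> st; apply: envelope_le; first exact: envelope_ge0.
move=> p Ap; apply: le_trans (envelope_ge s Ap).
by rewrite lerD2l lerN2 ge_max !le_max lexx/= lerD2r st orbT.
Qed.

Lemma envelope_lipschitz s t : s <= t -> envelope s <= envelope t + (t - s).
Proof.
move=> st; apply: envelope_le => [|p Ap].
  by rewrite addr_ge0 ?envelope_ge0// subr_ge0.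
rewrite -lerBlDr; apply: le_trans (envelope_ge t Ap).
rewrite -addrA lerD2l -opprD lerN2 ge_max.
have max0 : 0 <= Num.max 0 (s - p.1) by rewrite le_max lexx.
have maxs : s - p.1 <= Num.max 0 (s - p.1) by rewrite le_max lexx orbT.
by apply/andP; split; move: st max0 maxs; lra.
Qed.

Lemma envelope_continuous : continuous envelope.
Proof.
move=> x; apply/cvgrPdist_le => e e0; near=> y.
have : `|x - y| <= e by near: y; exact: (@cvgr_dist_le _ _ _ _ _ id).
apply: le_trans; have [xy|/ltW yx] := leP x y.
- rewrite ger0_norm ?subr_ge0 ?envelope_nonincreasing//.
  by rewrite lerBlDl distrC ger0_norm ?subr_ge0// envelope_lipschitz.
- rewrite distrC ger0_norm ?subr_ge0 ?envelope_nonincreasing//.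
  by rewrite lerBlDl ger0_norm ?subr_ge0// envelope_lipschitz.
Unshelve. all: by end_near. Qed.

(** The points later than [T] contribute at most [e] at any time, and those
    before [T] contribute nothing after time [T + M], as they start at height at
    most [M] and decrease at unit speed. *)
Lemma envelope_cvg0 :
  (forall e, 0 < e -> exists T, forall p, A p -> T <= p.1 -> p.2 <= e) ->
  envelope t @[t --> +oo] --> (0 : R).
Proof.
move=> Ae; apply/cvgr0Pnorm_le => e e0; have [T AT] := Ae e e0.
near=> t; rewrite ger0_norm ?envelope_ge0//.
apply: envelope_le => [|p Ap]; first exact: ltW.
have [Tp|/ltW pT] := leP T p.1.
  by rewrite (le_trans _ (AT p Ap Tp))// gerBl le_max lexx.
have tT : T + M <= t by near: t; by apply: nbhs_pinfty_ge; rewrite num_real.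
have := AM Ap; have : t - p.1 <= Num.max 0 (t - p.1)
  by rewrite le_max lexx orbT.
by move: pT tT e0; lra.
Unshelve. all: by end_near. Qed.

End Envelope.

(** * Strict decrease *)

Section ClassL.
Variable R : realType.

Lemma class_L_add_expR (f : R -> R) (c : R) : 0 < c ->
  continuous f -> {homo f : s t / s <= t >-> t <= s} ->
  f t @[t --> +oo] --> (0 : R) ->
  class_L (fun t => f t + c * expR (- t)).
Proof.
move=> c0 cf df f0; split.
- apply: continuous_subspaceT => t; apply: cvgD; first exact: cf.
  apply: cvgM; first exact: cvg_cst.
  apply: (@continuous_comp _ _ _ -%R expR); first exact: opp_continuous.
  exact: continuous_expR.
- move=> s t _ _ st /=; apply: ler_ltD; first by apply: df; exact: ltW.
  by rewrite ltr_pM2l// ltr_expR ltrN2.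
- rewrite -[0]addr0 -{2}(mulr0 c); apply: cvgD => //.
  by apply: cvgM; [exact: cvg_cst|exact: cvgr_expR].
Qed.

End ClassL.

(** * Implications between the stability properties *)

Section Equivalence.
Variables (R : realType) (X V : normedModType R) (S : control_system X V).

Let norm0 u (Su : inputs S u) : 0 <= input_norm S u := input_norm_ge0 Su.

Lemma phi_restart x u (s t : {nonneg R}) : inputs S u -> s%:num <= t%:num ->
  exists h, phi S t x u = phi S h (phi S s x u) (Defs.shift s u).
Proof.
move=> Su st; have h0 : 0 <= t%:num - s%:num by rewrite subr_ge0.
exists (NngNum h0); rewrite phi_cocycle//; congr phi.
by apply/val_inj => /=; rewrite addrC subrK.
Qed.

Lemma sISS_UGS : sISS S -> UGS S.
Proof.
move=> [g [s [b [Kg Ks b0 bL [bs bg]]]]].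
have [g' Kg' gg'] := gain_majorant (or_introl Kg).
exists s, g'; split=> // [|x u t Su]; first by left.
by rewrite (le_trans (bg x u t Su))// lerD// ?bs// gg' ?norm0.
Qed.

Lemma sISS_sAG : sISS S -> sAG S.
Proof.
move=> [g [s [b [Kg [Ks _] b0 bL [bs bg]]]]].
have [g' Kg' gg'] := gain_majorant (or_introl Kg).
exists g'; first by left.
move=> x e e0.
suff [T bT] : exists T : {nonneg R}, forall t, T%:num <= t -> b x t <= e.
  exists T => u t Su Tt; rewrite (le_trans (bg x u t Su))//.
  by rewrite lerD ?bT ?gg' ?norm0.
have [->|x0] := eqVneq x 0.
  (* [b x] is in class L only for [x != 0]; at the origin, [b 0 t <= s 0 = 0]. *)
  exists 0%:nng => t /= t0; rewrite (le_trans (bs 0 t t0))//.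
  by case: Ks => _ _; rewrite normr0 => ->; exact: ltW.
have [_ _ /cvgr0Pnorm_le/(_ e e0)[T [_ bT]]] := bL x x0.
(* The limit only provides a real [T], possibly negative, that works for
   [t > T]. *)
exists (`|T| + 1)%:nng => t /= Tt; rewrite (le_trans (ler_norm _))// bT//.
by rewrite (lt_le_trans _ Tt)// (le_lt_trans (ler_norm T))// ltrDl.
Qed.

Lemma sAG_sLIM : sAG S -> sLIM S.
Proof.
move=> [g Kg Sg]; exists g; first by case: Kg => [[]|]; [left|right].
move=> e x e0; have [T gT] := Sg x e e0.
by exists T => u Su; exists T => //; exact: gT.
Qed.

Lemma sLIM_UGS_sAG : sLIM S -> UGS S -> sAG S.
Proof.
move=> [g /gain_majorant[g1 Kg1 gg1] lim] [s [h [Ks Kh ugs]]].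
have [g2 Kg2 hg2] : exists2 g', class_Kinf g' & forall r, 0 <= r -> h r <= g' r.
  by apply: gain_majorant; case: Kh => [[]|]; [left|right].
exists (fun r => s (g1 r + g1 r) + g2 r).
  left; apply: class_KinfD => //.
  apply: (proj1 (class_Kinf_comp Ks (class_KinfD (proj1 Kg1) Kg1))).
move=> x e e0; have [d d0 sd] := class_K_small (proj1 Ks) e0.
have d20 : 0 < d / 2 by rewrite divr_gt0.
have [T limT] := lim _ x d20.
exists T => u t Su Tt; have [r rT xr] := limT u Su.
have [k ->] := phi_restart x Su (le_trans rT Tt).
apply: (le_trans (ugs _ _ _ (inputs_shift _ Su))).
have gu0 : 0 <= g1 (input_norm S u) by apply: class_K_ge0 (proj1 Kg1) (norm0 Su).
rewrite addrA lerD//; last first.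
  rewrite (le_trans (hg2 _ (norm0 (inputs_shift _ Su))))//.
  rewrite (class_K_le (proj1 Kg2)) ?input_norm_shift//.
  by apply: norm0; exact: inputs_shift.
apply: (@le_trans _ _ (s (d / 2 + g1 (input_norm S u)))).
  by rewrite (class_K_le (proj1 Ks))// (le_trans xr)// lerD2l gg1 ?norm0.
apply: (le_trans (class_K_split (proj1 Ks) (ltW d20) gu0)).
by rewrite -splitr lerD2r.
Qed.

Lemma sAG_UGS_sISS : sAG S -> UGS S -> sISS S.
Proof.
move=> [g Kg Sg] [s [h [Ks Kh ugs]]].
have [g1 Kg1 gg1] : exists2 g', class_Kinf g' & forall r, 0 <= r -> g r <= g' r.
  by apply: gain_majorant; case: Kg => [[]|]; [left|right].
have [g2 Kg2 hg2] : exists2 g', class_Kinf g' & forall r, 0 <= r -> h r <= g' r.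
  by apply: gain_majorant; case: Kh => [[]|]; [left|right].
pose G r := g1 r + g2 r.
have KG : class_Kinf G by apply: class_KinfD (proj1 Kg1) Kg2.
have gG r : 0 <= r -> g r <= G r.
  by move=> r0; rewrite (le_trans (gg1 _ r0))// lerDl (class_K_ge0 (proj1 Kg2)).
have hG r : 0 <= r -> h r <= G r.
  by move=> r0; rewrite (le_trans (hg2 _ r0))// lerDr (class_K_ge0 (proj1 Kg1)).
pose A x : set (R * R) := [set p | exists (t : {nonneg R}) u,
  inputs S u /\ p = (t%:num, `|phi S t x u| - G (input_norm S u))].
have s0 (x : X) : 0 <= s `|x| by apply: class_K_ge0 (proj1 Ks) _.
have AM x p : A x p -> p.2 <= s `|x|.
  move=> [t [u [Su ->]]] /=; rewrite lerBlDr (le_trans (ugs x u t Su))//.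
  by rewrite lerD2l hG ?norm0.
have Ae x e : 0 < e -> exists T, forall p, A x p -> T <= p.1 -> p.2 <= e.
  move=> e0; have [T gT] := Sg x e e0; exists T%:num => p [t [u [Su ->]]] /= Tt.
  by rewrite lerBlDr (le_trans (gT u t Su Tt))// lerD2l gG ?norm0.
exists G, (fun r => s r + r), (fun x t => envelope (A x) t + `|x| * expR (- t)).
split.
- exact: (proj1 KG).
- exact: class_KinfD (proj1 Ks) (class_Kinf_id R).
- move=> x t t0; rewrite addr_ge0 ?mulr_ge0 ?expR_ge0//.
  exact: envelope_ge0 (s0 x) (@AM x) t.
- move=> x x0; apply: class_L_add_expR; first by rewrite normr_gt0.
  + exact: envelope_continuous (s0 x) (@AM x).
  + move=> a b; exact: envelope_nonincreasing (s0 x) (@AM x) _ _.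
  + exact: envelope_cvg0 (s0 x) (@AM x) (Ae x).
- split=> [x t t0|x u t Su].
    rewrite lerD ?(envelope_bounded (s0 x) (@AM x))// ler_piMr//.
    by rewrite -expR0 ler_expR oppr_le0.
  rewrite -lerBlDr; apply: le_trans (_ : envelope (A x) t%:num <= _).
    have Ap : A x (t%:num, `|phi S t x u| - G (input_norm S u)) by exists t, u.
    exact: (envelope_majorant (s0 x) (@AM x) Ap).
  by rewrite lerDl mulr_ge0 ?expR_ge0.
Qed.

End Equivalence.

Theorem theorem12 (R : realType) (X V : normedModType R)
    (S : control_system X V) :
  (sISS S <-> sAG S /\ UGS S) /\ (sAG S /\ UGS S <-> sLIM S /\ UGS S).
Proof.
split; split.
- by move=> iss; split; [exact: sISS_sAG|exact: sISS_UGS].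
- by move=> [ag ugs]; exact: sAG_UGS_sISS.
- by move=> [ag ugs]; split=> //; exact: sAG_sLIM.
- by move=> [lim ugs]; split=> //; exact: sLIM_UGS_sAG.
Qed.
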